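(* Let $n$ be a positive even integer. If there exists an orthogonal array $\mathrm{OA}(N,n,2,\frac n2-1)$, then $$N>\frac{0.409}{n}\cdot 2^n .$$
   Context: An orthogonal array $\mathrm{OA}(N,n,2,t)$ is a nonempty multiset $C$ of $N$ (counted with multiplicity) binary $n$-tuples from $\{0,1\}^n$ such that for any distinct coordinates $i_1,\ldots,i_t\in\{1,\ldots,n\}$ and any $a_1,\ldots,a_t\in\{0,1\}$, the number (with multiplicity) of $(x_1,\ldots,x_n)\in C$ with $x_{i_j}=a_j$, $j=1,\ldots,t$, equals $N/2^t$. *)

(* Defs.v *)
From mathcomp Require Export all_boot all_order all_algebra.
From mathcomp Require Export finmap multiset.

Set Implicit Arguments.
Unset Strict Implicit.
Unset Printing Implicit Defensive.

Import GRing.Theory Num.Theory.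
Local Open Scope mset_scope.
Local Open Scope ring_scope.

(* [size] and [count] act on [enum_mset C], in which each tuple is repeated
   according to its multiplicity. *)
Definition orthogonal_array (N n t : nat) (C : {mset n.-tuple bool}) : Prop :=
  [/\ C <> mset0,
      size C = N &
      forall (i : 'I_t -> 'I_n) (a : 'I_t -> bool), injective i ->
        (count (fun x : n.-tuple bool => [forall j, tnth x (i j) == a j]) C)%:R
          = N%:R / 2 ^+ t :> rat].

(* Main.v *)
Require Import Defs.
From mathcomp Require Import all_boot all_order all_algebra.
From mathcomp Require Import finmap multiset.
From mathcomp Require Import zify ring lra.

Set Implicit Arguments.
Unset Strict Implicit.
Unset Printing Implicit Defensive.

Import Order.TTheory GRing.Theory Num.Theory.
Local Open Scope mset_scope.
Local Open Scope ring_scope.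

(** Write F for the character sum of the array, n for its number of columns and
    K(U) = n - 2|U|, which is the sum of the n characters of weight one.
    Products of F and K have nonnegative Walsh coefficients, so for c >= 0 the
    sum over U of F^2 K (K + c)^2 = F^2 (K^3 + 2 c K^2 + c^2 K) is at least that
    of 2 c F^2 K^2, which is at least 2 c N n 2^n (diagonal terms only).
    Conversely F(U) = 0 for 0 < |U| < n/2 by the strength of the array, and
    K(U) <= 0 for |U| >= n/2, so the sum is at most its term at the empty set,
    namely N^2 n (n + c)^2.  The optimal choice c = n gives N >= 2^n / (2 n). *)

Section WalshCharacters.

Variables (R : numDomainType) (I : finType).
Implicit Types (a b : I -> bool) (U : {set I}) (F : {set I} -> R).

Definition walsh a U : R := \prod_(i in U) (-1) ^+ a i.

Lemma walsh_set0 a : walsh a set0 = 1.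
Proof. exact: big_set0. Qed.

Lemma walshM a b U : walsh a U * walsh b U = walsh (fun i => a i (+) b i) U.
Proof. by rewrite -big_split; apply: eq_bigr => i _; rewrite signr_addb. Qed.

Lemma walsh_sqr a U : walsh a U ^+ 2 = 1.
Proof. by rewrite expr2 walshM /walsh big1 // => i _; rewrite addbb. Qed.

Lemma sum_walsh_ge0 a : 0 <= \sum_U walsh a U.
Proof.
rewrite (eq_bigr (fun U => \prod_i if i \in U then (-1) ^+ a i else 1)).
  rewrite -bigA_distr; apply: prodr_ge0 => i _ /=.
  by case: (a i); rewrite ?expr1 ?addNr ?addr_ge0.
by move=> U _; rewrite -big_mkcond.
Qed.

Definition walsh_nneg F : Prop := forall a, 0 <= \sum_U F U * walsh a U.

Lemma walsh_nneg1 : walsh_nneg (fun=> 1).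
Proof.
by move=> a; under eq_bigr do rewrite mul1r; apply: sum_walsh_ge0.
Qed.

Lemma walsh_nneg_sum_ge0 F : walsh_nneg F -> 0 <= \sum_U F U.
Proof.
move=> /(_ (fun=> false)); congr (0 <= _); apply: eq_bigr => U _.
by rewrite /walsh big1 ?mulr1.
Qed.

Definition walsh_sum (J : finType) (s : J -> I -> bool) U : R :=
  \sum_j walsh (s j) U.

Lemma walsh_sum_set0 (J : finType) (s : J -> I -> bool) :
  walsh_sum s set0 = #|J|%:R.
Proof.
by rewrite -sumr_const; apply: eq_bigr => j _; apply: walsh_set0.
Qed.

Lemma walsh_nneg_sumM (J : finType) (s : J -> I -> bool) F :
  walsh_nneg F -> walsh_nneg (fun U => walsh_sum s U * F U).
Proof.
move=> F_nneg a; under eq_bigr do rewrite /walsh_sum !mulr_suml.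
rewrite exchange_big; apply: sumr_ge0 => j _ /=.
by under eq_bigr do rewrite mulrAC walshM mulrC.
Qed.

Lemma walsh_nneg_sumX (J : finType) (s : J -> I -> bool) k F :
  walsh_nneg F -> walsh_nneg (fun U => walsh_sum s U ^+ k * F U).
Proof.
move=> F_nneg; elim: k => [|k IHk] a.
  by under eq_bigr do rewrite expr0 mul1r.
under eq_bigr do rewrite exprS -[_ * _ * F _]mulrA.
exact: (walsh_nneg_sumM s IHk).
Qed.

Lemma sum_walsh_sum_sqr_ge (J : finType) (s : J -> I -> bool) F :
  walsh_nneg F ->
  #|J|%:R * \sum_U F U <= \sum_U walsh_sum s U ^+ 2 * F U.
Proof.
move=> F_nneg.
have -> : \sum_U walsh_sum s U ^+ 2 * F U =
    \sum_j \sum_k \sum_U F U * walsh (fun i => s j i (+) s k i) U.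
  under eq_bigr do rewrite expr2 big_distrlr mulr_suml.
  rewrite exchange_big; apply: eq_bigr => j _.
  under eq_bigr do rewrite mulr_suml.
  rewrite exchange_big; apply: eq_bigr => k _.
  by apply: eq_bigr => U _; rewrite /= walshM mulrC.
rewrite mulr_natl -sumr_const; apply: ler_sum => j _.
rewrite (bigD1 j) //= -[leLHS]addr0 lerD ?sumr_ge0 //.
by apply: ler_sum => U _; rewrite -walshM -expr2 walsh_sqr mulr1.
Qed.

Definition krawtchouk1 U : R := #|I|%:R - 2 * #|U|%:R.

Lemma krawtchouk1E U : krawtchouk1 U = walsh_sum (fun i : I => eq_op i) U.
Proof.
rewrite /krawtchouk1 -sumr_const -sum1_card natr_sum mulr_sumr.
rewrite [X in _ - X]big_mkcond -sumrB; apply: eq_bigr => i _; rewrite /walsh.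
case: ifPn => [iU|iNU].
  rewrite (bigD1 i) //= eqxx big1 ?mulr1 => [|j /andP[_]]; last first.
    by rewrite eq_sym => /negbTE ->.
  by ring.
by rewrite subr0 big1 // => j jU; case: eqP iNU jU => // -> /negbTE ->.
Qed.

Lemma krawtchouk1_set0 : krawtchouk1 set0 = #|I|%:R.
Proof. by rewrite /krawtchouk1 cards0 mulr0 subr0. Qed.

Lemma krawtchouk1_le0 U : (#|I| <= #|U|.*2)%N -> krawtchouk1 U <= 0.
Proof. by rewrite subr_le0 -natrM ler_nat mul2n. Qed.

Lemma sum_krawtchouk1_sqr_ge :
  #|I|%:R * 2 ^+ #|I| <= \sum_U krawtchouk1 U ^+ 2.
Proof.
have := sum_walsh_sum_sqr_ge (fun i : I => eq_op i) walsh_nneg1.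
rewrite sumr_const -[#|{set I}|]cardsT -powersetT card_powerset cardsT natrX.
by congr (_ <= _); apply: eq_bigr => U _; rewrite mulr1 -krawtchouk1E.
Qed.

Lemma walsh_nneg_krawtchouk1X k : walsh_nneg (fun U => krawtchouk1 U ^+ k).
Proof.
move=> a; under eq_bigr do rewrite krawtchouk1E -[_ ^+ k]mulr1.
exact: walsh_nneg_sumX walsh_nneg1 a.
Qed.

End WalshCharacters.

Section HalfSpectrumBound.

Variables (R : realDomainType) (I J : finType) (s : J -> I -> bool).

Local Notation F := (walsh_sum R s).
Local Notation K := (@krawtchouk1 R I).

Lemma sum_walsh_sum_cubic_ge (c : R) : 0 <= c ->
  2 * c * (#|J|%:R * (#|I|%:R * 2 ^+ #|I|))
    <= \sum_U F U ^+ 2 * (K U * (K U + c) ^+ 2).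
Proof.
move=> c_ge0.
have -> : \sum_U F U ^+ 2 * (K U * (K U + c) ^+ 2) =
    \sum_U F U ^+ 2 * K U ^+ 3 + 2 * c * \sum_U F U ^+ 2 * K U ^+ 2
      + c ^+ 2 * \sum_U F U ^+ 2 * K U ^+ 1.
  by rewrite !mulr_sumr -!big_split; apply: eq_bigr => U _ /=; ring.
have moment_ge0 k : 0 <= \sum_U F U ^+ 2 * K U ^+ k.
  apply/walsh_nneg_sum_ge0/walsh_nneg_sumX.
  exact: walsh_nneg_krawtchouk1X.
rewrite ler_wpDr ?mulr_ge0 ?sqr_ge0 // ler_wpDl // ler_wpM2l ?mulr_ge0 //.
apply: le_trans (sum_walsh_sum_sqr_ge s (walsh_nneg_krawtchouk1X R 2)).
by rewrite ler_wpM2l // sum_krawtchouk1_sqr_ge.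
Qed.

Hypothesis F_eq0 : forall U, U != set0 -> (#|U|.*2 < #|I|)%N -> F U = 0.

Lemma sum_walsh_sum_cubic_le (c : R) :
  \sum_U F U ^+ 2 * (K U * (K U + c) ^+ 2)
    <= #|J|%:R ^+ 2 * (#|I|%:R * (#|I|%:R + c) ^+ 2).
Proof.
rewrite (bigD1 set0) //= walsh_sum_set0 krawtchouk1_set0.
rewrite gerDl; apply: sumr_le0 => U U_neq0.
have [U_lt|U_ge] := ltnP #|U|.*2 #|I|.
  by rewrite F_eq0 // expr0n mul0r.
by rewrite mulr_ge0_le0 ?sqr_ge0 // mulr_le0_ge0 ?sqr_ge0 // krawtchouk1_le0.
Qed.

Lemma half_spectrum_bound : (0 < #|I|)%N -> (0 < #|J|)%N ->
  2 ^+ #|I| <= 2 * #|I|%:R * #|J|%:R :> R.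
Proof.
move=> I_gt0 J_gt0.
have factor_gt0 : 0 < 2 * #|I|%:R ^+ 2 * #|J|%:R :> R.
  by rewrite !mulr_gt0 ?exprn_gt0 ?ltr0n.
rewrite -(ler_pM2l factor_gt0).
have := le_trans (sum_walsh_sum_cubic_ge (ler0n R #|I|))
                 (sum_walsh_sum_cubic_le #|I|%:R).
by congr (_ <= _); ring.
Qed.

End HalfSpectrumBound.

Section OrdCons.

Variables (T : eqType) (t : nat).
Implicit Types (x : T) (f : 'I_t -> T).

Definition ord_cons x f (j : 'I_t.+1) : T := oapp f x (unlift ord0 j).

Lemma ord_cons0 x f : ord_cons x f ord0 = x.
Proof. by rewrite /ord_cons unlift_none. Qed.

Lemma ord_consS x f j : ord_cons x f (lift ord0 j) = f j.
Proof. by rewrite /ord_cons liftK. Qed.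

Lemma ord_cons_inj x f :
  injective f -> x \notin codom f -> injective (ord_cons x f).
Proof.
move=> f_inj x_notin j1 j2; rewrite /ord_cons.
case: unliftP => [k1 ->|->]; case: unliftP => [k2 ->|->] //=.
- by move/f_inj ->.
- by move=> eq_x; rewrite -eq_x codom_f in x_notin.
- by move=> eq_x; rewrite eq_x codom_f in x_notin.
Qed.

End OrdCons.

Section OrthogonalArrays.

Variables (N n : nat) (C : {mset n.-tuple bool}).

Lemma orthogonal_array_gt0 t : orthogonal_array N t C -> (0 < N)%N.
Proof. by case=> /eqP C_neq0 <- _; rewrite lt0n size_mset_eq0. Qed.

Lemma orthogonal_arrayS t :
  (t < n)%N -> orthogonal_array N t.+1 C -> orthogonal_array N t C.
Proof.
move=> lt_tn [C_neq0 size_C OA]; split=> // i a i_inj.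
have /subsetPn[k _ k_notin] : ~~ ('I_n \subset codom i).
  apply/negP => /subset_leq_card.
  by rewrite card_codom // !card_ord leqNgt lt_tn.
pose matches (x : n.-tuple bool) := [forall j, tnth x (i j) == a j].
have halfE b : (count (fun x => matches x && (tnth x k == b)) C)%:R
    = N%:R / 2 ^+ t.+1 :> rat.
  rewrite -(OA _ (ord_cons b a) (ord_cons_inj i_inj k_notin)).
  congr _%:R; apply: eq_count => x.
  apply/andP/forallP => [[/forallP x_i x_k] | x_cons].
    by move=> j; case: (unliftP ord0 j) => [j' ->|->];
      rewrite ?ord_consS ?ord_cons0.
  split; last by have := x_cons ord0; rewrite !ord_cons0.
  by apply/forallP => j; have := x_cons (lift ord0 j); rewrite !ord_consS.
have -> : count matches C = (count (fun x => matches x && (tnth x k == true)) C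
    + count (fun x => matches x && (tnth x k == false)) C)%N.
  rewrite -!sum1_count (bigID (fun x => tnth x k)) /=.
  by congr (_ + _)%N; apply: eq_bigl => x; rewrite ?eqb_id ?eqbF_neg.
by rewrite natrD !halfE exprS; field; rewrite expf_neq0.
Qed.

Lemma orthogonal_arrayW t t' : (t' <= t <= n)%N ->
  orthogonal_array N t C -> orthogonal_array N t' C.
Proof.
elim: t => [|t IHt]; first by rewrite leqn0 => /andP[/eqP ->].
rewrite leq_eqVlt ltnS => /andP[/orP[/eqP -> //|le_t't] lt_tn].
move/(orthogonal_arrayS lt_tn); apply: IHt.
by rewrite le_t't ltnW.
Qed.

Lemma orthogonal_array_sum t (i : 'I_t -> 'I_n)
    (g : {ffun 'I_t -> bool} -> rat) :
  orthogonal_array N t C -> injective i ->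
  \sum_(x <- C) g [ffun j => tnth x (i j)] = N%:R / 2 ^+ t * \sum_a g a.
Proof.
move=> [_ _ OA] i_inj.
rewrite (partition_big (fun x => [ffun j => tnth x (i j)]) predT) //= mulr_sumr.
apply: eq_bigr => a _; rewrite (eq_bigr (fun=> g a)) => [|x /eqP -> //].
rewrite -(OA i a i_inj) big_const_seq iter_addr_0 mulr_natl.
congr (_ *+ _); apply: eq_count => x.
apply/eqP/forallP => [<- j|eq_xa]; first by rewrite ffunE.
by apply/ffunP => j; rewrite ffunE; apply/eqP.
Qed.

Lemma orthogonal_array_walsh_eq0 t (U : {set 'I_n}) :
  orthogonal_array N t C -> U != set0 -> (#|U| <= t <= n)%N ->
  \sum_(x <- C) walsh rat (tnth x) U = 0.
Proof.
rewrite -card_gt0 => OA U_gt0 /orthogonal_arrayW/(_ OA) OA_U.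
under eq_bigr do rewrite /walsh big_enum_val.
pose g (a : {ffun 'I_#|U| -> bool}) : rat := \prod_j (-1) ^+ a j.
transitivity (\sum_(x <- C) g [ffun j => tnth x (enum_val j)]).
  by apply: eq_bigr => x _; apply: eq_bigr => j _; rewrite ffunE.
rewrite (orthogonal_array_sum _ OA_U enum_val_inj) /g.
rewrite -(bigA_distr_bigA (fun _ (b : bool) => (-1) ^+ b)) /=.
rewrite big_bool /= expr1 addNr prodr_const card_ord.
by rewrite expr0n gtn_eqF // mulr0.
Qed.

Lemma orthogonal_array_half_strength_bound t :
  (0 < n)%N -> (t <= n <= t.+1.*2)%N -> orthogonal_array N t C ->
  2 ^+ n <= 2 * n%:R * N%:R :> rat.
Proof.
move=> n_gt0 /andP[le_tn le_nt] OA; have [_ size_C _] := OA.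
pose s (j : 'I_(size C)) := tnth (tnth (in_tuple C) j).
have := @half_spectrum_bound rat _ _ s.
rewrite -size_C !card_ord; apply=> //; last first.
  by rewrite size_C; apply: orthogonal_array_gt0 OA.
move=> U U_neq0 U_lt.
rewrite -(orthogonal_array_walsh_eq0 OA U_neq0) ?le_tn ?andbT.
  by rewrite [RHS]big_tnth.
by rewrite -ltnS -ltn_double (leq_trans U_lt).
Qed.

End OrthogonalArrays.

Theorem mainTheorem6 (n N : nat) (n_gt0 : (0 < n)%N) (n_even : ~~ odd n)
    (OA_ex : exists C : {mset n.-tuple bool},
       orthogonal_array N (n %/ 2 - 1)%N C) :
  (N%:R : rat) > (409 / 1000) / n%:R * 2 ^+ n.
Proof.
have [C OA] := OA_ex.
have strength : (n %/ 2 - 1 <= n <= (n %/ 2 - 1).+1.*2)%N by lia.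
have bound := orthogonal_array_half_strength_bound n_gt0 strength OA.
have nR_gt0 : 0 < n%:R :> rat by rewrite ltr0n.
have pow_gt0 : 0 < 2 ^+ n :> rat by rewrite exprn_gt0.
rewrite mulrAC ltr_pdivrMr; lra.
Qed.
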